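(* Let $x_0,y_0\in\mathbb{R}$ and $\theta\in C^2(\mathbb{R})$, and let $$\Sigma=\{(x,y,z)\in\mathbb{R}^3:\ (x-x_0)\cos\theta(t)+(y-y_0)\sin\theta(t)=0,\ \text{ where } t=z-y_0x+x_0y\}.$$ Then $\Sigma$ has no singular points if and only if $\theta'(t)\ge 0$ for all $t\in\mathbb{R}$.
   Context: The Heisenberg group $H_1$ is identified with $\mathbb{R}^3$, with contact form $\Theta=dz+x\,dy-y\,dx$. The set $\Sigma$ is a $C^2$ surface in $H_1$. A point $p\in\Sigma$ is singular if the tangent plane $T_p\Sigma$ coincides with the contact plane $\ker\Theta_p$ (spanned by $\hat e_1=\partial_x+y\,\partial_z$ and $\hat e_2=\partial_y-x\,\partial_z$ at $p$). *)

(* Defs.v *)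
From Stdlib Require Import Reals Lra FunctionalExtensionality.
From Coquelicot Require Import Coquelicot.
Open Scope R_scope.

(** Concrete reals of Stdlib, with Coquelicot.  The Heisenberg group is identified with R^3,
    carried by the product normed module [R * R * R]; its group law plays no
    role here, only the contact form does. *)
Notation R3 := (R * R * R)%type.

Inductive axis := Ax | Ay | Az.

Definition coord (i : axis) (p : R3) : R :=
  let '(x, y, z) := p in match i with Ax => x | Ay => y | Az => z end.

Definition upd (i : axis) (p : R3) (s : R) : R3 :=
  let '(x, y, z) := p in
  match i with Ax => (s, y, z) | Ay => (x, s, z) | Az => (x, y, s) end.

Definition partial (i : axis) (f : R3 -> R) (p : R3) : R :=
  Derive (fun s => f (upd i p s)) (coord i p).

Fixpoint C_k (n : nat) (f : R -> R) : Prop :=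
  match n with
  | O => forall t, continuous f t
  | S m => (forall t, ex_derive f t) /\ C_k m (Derive f)
  end.

(** Class C^n via iterated partial derivatives; meant for U open. *)
Fixpoint C_k_on (n : nat) (U : R3 -> Prop) (f : R3 -> R) : Prop :=
  match n with
  | O => forall p, U p -> continuous f p
  | S m => forall i,
      (forall p, U p -> ex_derive (fun s => f (upd i p s)) (coord i p)) /\
      C_k_on m U (partial i f)
  end.

(** Embedded C^2 surfaces: near each of its points, the set is the zero locus
    of a C^2 function with non-vanishing gradient. *)
Definition is_C2_surface (S : R3 -> Prop) : Prop :=
  forall p, S p ->
  exists (U : R3 -> Prop) (f : R3 -> R),
    open U /\ U p /\ C_k_on 2 U f /\
    (exists i, partial i f p <> 0) /\
    (forall q, U q -> (S q <-> f q = 0)).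

Record C2_surface := {
  carrier :> R3 -> Prop;
  carrier_C2 : is_C2_surface carrier
}.

(** T_pS as the set of velocities at p of C^1 curves lying in S. *)
Definition tangent_plane (S : C2_surface) (p v : R3) : Prop :=
  exists c c' : R -> R3,
    c 0 = p /\ c' 0 = v /\
    locally 0 (fun s => S (c s) /\ is_derive c s (c' s) /\ continuous c' s).

(** Theta = dz + x dy - y dx, at p = (x, y, z), applied to v = (a, b, c). *)
Definition Theta (p v : R3) : R :=
  let '(x, y, z) := p in let '(a, b, c) := v in c + x * b - y * a.

Definition contact_plane (p v : R3) : Prop := Theta p v = 0.

Definition singular_point (S : C2_surface) (p : R3) : Prop :=
  S p /\ forall v, tangent_plane S p v <-> contact_plane p v.

Definition Sigma_set (x0 y0 : R) (theta : R -> R) (p : R3) : Prop :=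
  let '(x, y, z) := p in
  let t := z - y0 * x + x0 * y in
  (x - x0) * cos (theta t) + (y - y0) * sin (theta t) = 0.

Lemma C_k_lin n : forall (a b c : R) (u v w : R -> R),
  C_k n u -> C_k n v -> C_k n w ->
  C_k n (fun t => a * u t + b * v t + c * w t).
Proof.
induction n as [|n IH]; simpl; intros a b c u v w Hu Hv Hw.
- intros t.
  apply (continuous_plus (fun t => a * u t + b * v t) (fun t => c * w t)).
  + apply (continuous_plus (fun t => a * u t) (fun t => b * v t)).
    * now apply (continuous_scal_r a u).
    * now apply (continuous_scal_r b v).
  + now apply (continuous_scal_r c w).
- destruct Hu as [Du Hu], Hv as [Dv Hv], Hw as [Dw Hw].
  assert (D : forall t, is_derive (fun t => a * u t + b * v t + c * w t) t
            (a * Derive u t + b * Derive v t + c * Derive w t)).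
  { intros t; auto_derive; [now repeat split | ].
    change (fun x => u x) with u; change (fun x => v x) with v;
    change (fun x => w x) with w; ring. }
  split; [intros t; eexists; apply D |].
  replace (Derive (fun t => a * u t + b * v t + c * w t))
    with (fun t => a * Derive u t + b * Derive v t + c * Derive w t).
  + now apply IH.
  + apply functional_extensionality; intros t; symmetry.
    now apply is_derive_unique.
Qed.

Definition height (x0 y0 : R) (p : R3) : R :=
  coord Az p - y0 * coord Ax p + x0 * coord Ay p.

(** A class of functions stable under partial derivatives that contains the
    defining function of [Sigma_set]. *)
Definition Gfun (x0 y0 : R) (u v w : R -> R) (p : R3) : R :=
  (coord Ax p - x0) * u (height x0 y0 p) + (coord Ay p - y0) * v (height x0 y0 p)
  + w (height x0 y0 p).

Definition ax (i : axis) := match i with Ax => 1 | _ => 0 end.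
Definition ay (i : axis) := match i with Ay => 1 | _ => 0 end.
Definition at' (x0 y0 : R) (i : axis) :=
  match i with Ax => - y0 | Ay => x0 | Az => 1 end.

Lemma Gfun_derive x0 y0 u v w i p :
  (forall t, ex_derive u t) -> (forall t, ex_derive v t) ->
  (forall t, ex_derive w t) ->
  is_derive (fun s => Gfun x0 y0 u v w (upd i p s)) (coord i p)
    (Gfun x0 y0
       (fun t => at' x0 y0 i * Derive u t + 0 * u t + 0 * u t)
       (fun t => at' x0 y0 i * Derive v t + 0 * v t + 0 * v t)
       (fun t => ax i * u t + ay i * v t + at' x0 y0 i * Derive w t) p).
Proof.
intros Du Dv Dw; destruct p as [[x y] z].
destruct i; unfold Gfun, height; simpl; auto_derive; try (now repeat split);
  change (fun x => u x) with u; change (fun x => v x) with v;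
  change (fun x => w x) with w; unfold Rminus; ring.
Qed.

Lemma height_continuous x0 y0 (p : R3) : continuous (height x0 y0) p.
Proof.
apply (continuous_ext
  (fun q : R3 => plus (plus (snd q) (scal (- y0) (fst (fst q))))
                      (scal x0 (snd (fst q))))).
{ intros [[x y] z]; unfold height, plus, scal; simpl.
  unfold mult; simpl; ring. }
apply (continuous_plus (fun q : R3 => plus (snd q) (scal (- y0) (fst (fst q))))).
- apply (continuous_plus (fun q : R3 => snd q)).
  + apply continuous_snd.
  + apply (continuous_scal_r (- y0) (fun q : R3 => fst (fst q))).
    apply (continuous_comp fst fst); apply continuous_fst.
- apply (continuous_scal_r x0 (fun q : R3 => snd (fst q))).
  apply (continuous_comp fst snd); [apply continuous_fst | apply continuous_snd].
Qed.

Lemma Gfun_C_k n x0 y0 : forall u v w,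
  C_k n u -> C_k n v -> C_k n w ->
  C_k_on n (fun _ => True) (Gfun x0 y0 u v w).
Proof.
assert (Lw : forall n (u : R -> R), C_k (S n) u -> C_k n u).
{ induction n0 as [|m IH]; intros u [D H].
  - intros t; apply (ex_derive_continuous u), D.
  - split; [exact D | now apply IH]. }
induction n as [|n IH]; intros u v w Hu Hv Hw.
- intros p _; unfold Gfun.
  pose proof (height_continuous x0 y0 p) as Ht.
  assert (C : forall h : R -> R, C_k 0 h ->
    continuous (fun q => h (height x0 y0 q)) p).
  { intros h Hh; apply (continuous_comp (height x0 y0) h); [exact Ht | apply Hh]. }
  assert (CX : continuous (fun q : R3 => coord Ax q - x0) p).
  { apply (continuous_minus (fun q : R3 => coord Ax q) (fun _ => x0)).
    - apply (continuous_ext (fun q : R3 => fst (fst q))); [now intros [[x y] z]|].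
      apply (continuous_comp fst fst); apply continuous_fst.
    - apply continuous_const. }
  assert (CY : continuous (fun q : R3 => coord Ay q - y0) p).
  { apply (continuous_minus (fun q : R3 => coord Ay q) (fun _ => y0)).
    - apply (continuous_ext (fun q : R3 => snd (fst q))); [now intros [[x y] z]|].
      apply (continuous_comp fst snd); [apply continuous_fst | apply continuous_snd].
    - apply continuous_const. }
  apply (continuous_plus (fun q => (coord Ax q - x0) * u (height x0 y0 q)
           + (coord Ay q - y0) * v (height x0 y0 q))).
  + apply (continuous_plus (fun q => (coord Ax q - x0) * u (height x0 y0 q))).
    * now apply (continuous_mult (fun q => coord Ax q - x0)); [|apply C].
    * now apply (continuous_mult (fun q => coord Ay q - y0)); [|apply C].
  + now apply C.
- pose proof (Lw _ _ Hu) as Lu; pose proof (Lw _ _ Hv) as Lv.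
  destruct Hu as [Du Hu], Hv as [Dv Hv], Hw as [Dw Hw].
  intros i; split.
  + intros p _; eexists; now apply Gfun_derive.
  + match goal with |- C_k_on _ _ ?f => replace f with
      (Gfun x0 y0
       (fun t => at' x0 y0 i * Derive u t + 0 * u t + 0 * u t)
       (fun t => at' x0 y0 i * Derive v t + 0 * v t + 0 * v t)
       (fun t => ax i * u t + ay i * v t + at' x0 y0 i * Derive w t)) end.
    * apply IH; now apply C_k_lin.
    * apply functional_extensionality; intros p; symmetry.
      now apply is_derive_unique, Gfun_derive.
Qed.

Lemma cos_sin_C2 theta : C_k 2 theta ->
  C_k 2 (fun t => cos (theta t)) /\ C_k 2 (fun t => sin (theta t)).
Proof.
intros [D1 [D2 H]].
assert (Cth : forall t, continuous theta t)
  by (intros; now apply (ex_derive_continuous theta)).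
assert (Cth' : forall t, continuous (Derive theta) t)
  by (intros; now apply (ex_derive_continuous (Derive theta))).
assert (Cc : forall t, continuous (fun t => cos (theta t)) t)
  by (intros t; apply (continuous_comp theta cos); [easy | apply continuous_cos]).
assert (Cs : forall t, continuous (fun t => sin (theta t)) t)
  by (intros t; apply (continuous_comp theta sin); [easy | apply continuous_sin]).
assert (M : forall f g : R -> R, (forall t, continuous f t) ->
  (forall t, continuous g t) -> forall t, continuous (fun t => f t * g t) t)
  by (intros; now apply (continuous_mult f g)).
assert (E1 : forall t, is_derive (fun t => cos (theta t)) t
   (- (Derive theta t * sin (theta t)))).
{ intros t; auto_derive; [easy|]. change (fun x => theta x) with theta; ring. }
assert (E2 : forall t, is_derive (fun t => sin (theta t)) t
   (Derive theta t * cos (theta t))).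
{ intros t; auto_derive; [easy|]. change (fun x => theta x) with theta; ring. }
assert (F1 : forall t, is_derive (fun t => - (Derive theta t * sin (theta t))) t
   (- (Derive (Derive theta) t * sin (theta t)
       + Derive theta t * (Derive theta t * cos (theta t))))).
{ intros t.
  apply (is_derive_opp (fun t => Derive theta t * sin (theta t))).
  apply (is_derive_mult (Derive theta) (fun t => sin (theta t)));
    [now apply Derive_correct | apply E2 | apply Rmult_comm]. }
assert (F2 : forall t, is_derive (fun t => Derive theta t * cos (theta t)) t
   (Derive (Derive theta) t * cos (theta t)
       + Derive theta t * - (Derive theta t * sin (theta t)))).
{ intros t.
  apply (is_derive_mult (Derive theta) (fun t => cos (theta t)));
    [now apply Derive_correct | apply E1 | apply Rmult_comm]. }
assert (X1 := functional_extensionality _ _ (fun t => is_derive_unique _ _ _ (E1 t))).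
assert (X2 := functional_extensionality _ _ (fun t => is_derive_unique _ _ _ (E2 t))).
assert (Y1 := functional_extensionality _ _ (fun t => is_derive_unique _ _ _ (F1 t))).
assert (Y2 := functional_extensionality _ _ (fun t => is_derive_unique _ _ _ (F2 t))).
change (Derive (fun t => cos (theta t)) = fun t => - (Derive theta t * sin (theta t))) in X1.
change (Derive (fun t => sin (theta t)) = fun t => Derive theta t * cos (theta t)) in X2.
split; simpl.
- rewrite X1; split; [intros t; eexists; apply E1 | split; [intros t; eexists; apply F1|]].
  intros t; apply (continuous_ext (fun t => - (Derive (Derive theta) t * sin (theta t)
       + Derive theta t * (Derive theta t * cos (theta t))))).
  { intros s; symmetry; apply is_derive_unique, F1. }
  apply (continuous_opp (fun t => Derive (Derive theta) t * sin (theta t)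
       + Derive theta t * (Derive theta t * cos (theta t)))).
  apply (continuous_plus (fun t => Derive (Derive theta) t * sin (theta t))).
  + now apply M.
  + apply (M (Derive theta) (fun t => Derive theta t * cos (theta t))); auto.
- rewrite X2; split; [intros t; eexists; apply E2 | split; [intros t; eexists; apply F2|]].
  intros t; apply (continuous_ext (fun t => Derive (Derive theta) t * cos (theta t)
       + Derive theta t * - (Derive theta t * sin (theta t)))).
  { intros s; symmetry; apply is_derive_unique, F2. }
  apply (continuous_plus (fun t => Derive (Derive theta) t * cos (theta t))).
  + now apply M.
  + apply (M (Derive theta) (fun t => - (Derive theta t * sin (theta t)))); auto.
    intros s; apply (continuous_opp (fun t => Derive theta t * sin (theta t))).
    now apply M.
Qed.

Lemma Sigma_set_C2 (x0 y0 : R) (theta : R -> R) :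
  C_k 2 theta -> is_C2_surface (Sigma_set x0 y0 theta).
Proof.
intros Hth p _.
destruct (cos_sin_C2 theta Hth) as [Hc Hs].
assert (H0 : C_k 2 (fun _ => 0)).
{ replace (fun _ : R => 0) with (fun t => 0 * theta t + 0 * theta t + 0 * theta t)
    by (apply functional_extensionality; intros; ring).
  now apply C_k_lin. }
set (u := fun t => cos (theta t)) in *; set (v := fun t => sin (theta t)) in *.
exists (fun _ => True), (Gfun x0 y0 u v (fun _ => 0)).
split; [apply open_true|]; split; [easy|]; split; [now apply Gfun_C_k|]; split.
- assert (P : forall i, partial i (Gfun x0 y0 u v (fun _ => 0)) p =
    (Gfun x0 y0
       (fun t => at' x0 y0 i * Derive u t + 0 * u t + 0 * u t)
       (fun t => at' x0 y0 i * Derive v t + 0 * v t + 0 * v t)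
       (fun t => ax i * u t + ay i * v t + at' x0 y0 i * Derive (fun _ => 0) t) p)).
  { intros i; apply is_derive_unique, Gfun_derive;
      [apply Hc | apply Hs | apply H0]. }
  pose proof (P Ax) as PX; pose proof (P Ay) as PY; pose proof (P Az) as PZ.
  destruct (Req_dec (partial Az (Gfun x0 y0 u v (fun _ => 0)) p) 0) as [Hz|Hz];
    [|now exists Az].
  destruct (Req_dec (u (height x0 y0 p)) 0) as [Hu|Hu].
  + exists Ay; rewrite PY; rewrite PZ in Hz.
    assert (Hv : v (height x0 y0 p) <> 0).
    { intros Hv; pose proof (sin2_cos2 (theta (height x0 y0 p))) as Q.
      unfold u, v in Hu, Hv; rewrite Hu, Hv in Q; unfold Rsqr in Q; lra. }
    intros E; apply Hv; unfold Gfun, at', ax, ay in *.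
    rewrite Derive_const in *.
    match type of Hz with ?l = 0 => match type of E with ?r = 0 =>
      replace (v (height x0 y0 p)) with (r - x0 * l) by ring; rewrite E, Hz; ring
    end end.
  + exists Ax; rewrite PX; rewrite PZ in Hz.
    intros E; apply Hu; unfold Gfun, at', ax, ay in *.
    rewrite Derive_const in *.
    match type of Hz with ?l = 0 => match type of E with ?r = 0 =>
      replace (u (height x0 y0 p)) with (r - (- y0) * l) by ring; rewrite E, Hz; ring
    end end.
- intros [[x y] z] _; unfold Gfun, height, u, v; simpl.
  now rewrite Rplus_0_r.
Qed.

Definition Sigma (x0 y0 : R) (theta : R -> R) (Htheta : C_k 2 theta) :
  C2_surface :=
  {| carrier := Sigma_set x0 y0 theta;
     carrier_C2 := Sigma_set_C2 x0 y0 theta Htheta |}.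

(* Main.v *)
Require Import Defs.
From Stdlib Require Import Reals Lra.
From Coquelicot Require Import Coquelicot.
Open Scope R_scope.

(** Write X = x - x0, Y = y - y0 and t = z - y0 x + x0 y.  The point is that the
    surface is ruled by horizontal lines, and that in coordinates adapted to the
    ruling both its conormal and the contact form are combinations of the same
    two independent forms

      alpha = cos(theta(t)) dx + sin(theta(t)) dy,    dt = dz - y0 dx + x0 dy.

    At a point p of the surface, (X, Y) is orthogonal to the unit vector
    (cos, sin)(theta(t)), so (X, Y) = r (- sin, cos)(theta(t)), where r is the
    signed distance along the ruling.  Differentiating the equation
    F = X cos(theta(t)) + Y sin(theta(t)), and substituting in
    Theta = dz + x dy - y dx = dt + X dy - Y dx, gives

      dF = alpha + r theta'(t) dt,    Theta = dt - r alpha.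

    The kernel of dF is the tangent plane ([tangent_plane_Sigma]), and the two
    kernels coincide exactly when the determinant 1 + r^2 theta'(t) vanishes.
    This cannot happen when theta' >= 0; and when theta'(t) < 0 for some t, it
    happens at the point of the line of height t where r = 1 / sqrt(- theta'(t)),
    since every value of (r, t) is attained on the surface. *)

(** * Curves in a product space *)

Lemma continuous_pair {T U V : UniformSpace} (f : T -> U) (g : T -> V) (s : T) :
  continuous f s -> continuous g s -> continuous (fun u => (f u, g u)) s.
Proof.
intros Hf Hg.
apply (continuous_comp_2 f g (fun a b => (a, b))); [easy | easy |].
apply (continuous_ext (fun p : U * V => p)); [now intros [a b] | apply continuous_id].
Qed.

Lemma is_derive_pair {K : AbsRing} {U V : NormedModule K}
    (f : K -> U) (g : K -> V) (s : K) (lf : U) (lg : V) :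
  is_derive f s lf -> is_derive g s lg ->
  is_derive (fun u => (f u, g u)) s (lf, lg).
Proof.
intros Hf Hg.
apply (filterdiff_comp'_2 f g (fun a b => (a, b)) s _ _ (fun a b => (a, b)) Hf Hg).
apply filterdiff_linear, is_linear_prod; [apply is_linear_fst | apply is_linear_snd].
Qed.

Lemma is_derive_fst {K : AbsRing} {U V : NormedModule K}
    (c : K -> U * V) (s : K) (l : U * V) :
  is_derive c s l -> is_derive (fun u => fst (c u)) s (fst l).
Proof.
intros H.
apply (filterdiff_comp' c fst s _ fst H).
apply filterdiff_linear, is_linear_fst.
Qed.

Lemma is_derive_snd {K : AbsRing} {U V : NormedModule K}
    (c : K -> U * V) (s : K) (l : U * V) :
  is_derive c s l -> is_derive (fun u => snd (c u)) s (snd l).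
Proof.
intros H.
apply (filterdiff_comp' c snd s _ snd H).
apply filterdiff_linear, is_linear_snd.
Qed.

(** * Coordinates and coframe adapted to the ruling *)

(** Signed distance from the axis x = x0, y = y0 along the ruling. *)
Definition radius (x0 y0 : R) (theta : R -> R) (p : R3) : R :=
  let '(x, y, z) := p in
  (y - y0) * cos (theta (height x0 y0 p)) - (x - x0) * sin (theta (height x0 y0 p)).

(** Its kernel contains the ruling direction (- sin, cos) at height t. *)
Definition alpha (x0 y0 : R) (theta : R -> R) (p v : R3) : R :=
  let '(a, b, c) := v in
  a * cos (theta (height x0 y0 p)) + b * sin (theta (height x0 y0 p)).

(** The differential of the defining equation of [Sigma_set]. *)
Definition dSigma (x0 y0 : R) (theta : R -> R) (p v : R3) : R :=
  alpha x0 y0 theta p v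
  + radius x0 y0 theta p * Derive theta (height x0 y0 p) * height x0 y0 v.

Definition ruled_point (x0 y0 : R) (theta : R -> R) (r t : R) : R3 :=
  (x0 - r * sin (theta t), y0 + r * cos (theta t),
   t + y0 * (x0 - r * sin (theta t)) - x0 * (y0 + r * cos (theta t))).

Lemma cos_sin_sqr (a : R) : cos a * cos a + sin a * sin a = 1.
Proof. pose proof (sin2_cos2 a) as Q; unfold Rsqr in Q; lra. Qed.

Lemma height_ruled_point x0 y0 theta r t :
  height x0 y0 (ruled_point x0 y0 theta r t) = t.
Proof. unfold height, ruled_point; simpl; ring. Qed.

Lemma Sigma_ruled_point x0 y0 theta r t :
  Sigma_set x0 y0 theta (ruled_point x0 y0 theta r t).
Proof.
pose proof (height_ruled_point x0 y0 theta r t) as H.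
unfold height, ruled_point in H; cbn [coord] in H.
unfold Sigma_set, ruled_point; rewrite H; ring.
Qed.

Lemma radius_ruled_point x0 y0 theta r t :
  radius x0 y0 theta (ruled_point x0 y0 theta r t) = r.
Proof.
pose proof (height_ruled_point x0 y0 theta r t) as H.
unfold radius, ruled_point in *; rewrite H.
transitivity (r * (cos (theta t) * cos (theta t) + sin (theta t) * sin (theta t)));
  [ring | rewrite cos_sin_sqr; ring].
Qed.

(** Resolving (X, Y) in the orthonormal frame (cos, sin), (- sin, cos): the
    equation of the surface kills the first component. *)
Lemma Sigma_ruled x0 y0 theta p :
  Sigma_set x0 y0 theta p ->
  p = ruled_point x0 y0 theta (radius x0 y0 theta p) (height x0 y0 p).
Proof.
destruct p as [[x y] z]; unfold Sigma_set, radius, ruled_point, height; simpl.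
set (t := z - y0 * x + x0 * y).
pose proof (cos_sin_sqr (theta t)) as Q; intros HS.
set (C := cos (theta t)) in *; set (S := sin (theta t)) in *.
assert (Ex : x = x0 - ((y - y0) * C - (x - x0) * S) * S).
{ transitivity (x0 + (x - x0) * (C * C + S * S) - C * ((x - x0) * C + (y - y0) * S));
    [rewrite Q, HS | ]; ring. }
assert (Ey : y = y0 + ((y - y0) * C - (x - x0) * S) * C).
{ transitivity (y0 + (y - y0) * (C * C + S * S) - S * ((x - x0) * C + (y - y0) * S));
    [rewrite Q, HS | ]; ring. }
rewrite <- Ex, <- Ey; unfold t; f_equal; ring.
Qed.

(** The contact form in the adapted coframe; [height x0 y0 v] is dt applied
    to v, because the height is linear. *)
Lemma Theta_coframe x0 y0 theta p v :
  Sigma_set x0 y0 theta p ->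
  Theta p v = height x0 y0 v - radius x0 y0 theta p * alpha x0 y0 theta p v.
Proof.
intros HS; pose proof (Sigma_ruled _ _ _ _ HS) as E.
destruct v as [[a b] c]; unfold alpha, height at 1; simpl.
set (r := radius x0 y0 theta p) in *; set (t := height x0 y0 p) in *.
rewrite E; unfold ruled_point; simpl; ring.
Qed.

(** * The tangent planes of the surface *)

Lemma C_k_ex_derive n theta : C_k (S n) theta -> forall t, ex_derive theta t.
Proof. now intros [D _]. Qed.

(** The chain rule, applied to the defining equation along a curve. *)
Lemma tangent_plane_dSigma x0 y0 theta Htheta p v :
  tangent_plane (Sigma x0 y0 theta Htheta) p v -> dSigma x0 y0 theta p v = 0.
Proof.
intros (c & c' & <- & <- & Hloc).
pose proof (C_k_ex_derive _ _ Htheta) as D.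
destruct (locally_singleton _ _ Hloc) as (_ & Dc & _).
pose proof (is_derive_fst _ _ _ (is_derive_fst _ _ _ Dc)) as Dx.
pose proof (is_derive_snd _ _ _ (is_derive_fst _ _ _ Dc)) as Dy.
pose proof (is_derive_snd _ _ _ Dc) as Dz.
set (x := fun u => fst (fst (c u))) in *.
set (y := fun u => snd (fst (c u))) in *.
set (z := fun u => snd (c u)) in *.
set (t := fun u => z u - y0 * x u + x0 * y u).
set (dt := snd (c' 0) - y0 * fst (fst (c' 0)) + x0 * snd (fst (c' 0))).
assert (Dt : is_derive t 0 dt).
{ unfold t, dt; auto_derive.
  - repeat split; eexists; eassumption.
  - change (fun u => x u) with x; change (fun u => y u) with y;
      change (fun u => z u) with z.
    rewrite (is_derive_unique x _ _ Dx), (is_derive_unique y _ _ Dy),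
      (is_derive_unique z _ _ Dz).
    destruct (c' 0) as [[v1 v2] v3]; simpl; ring. }
set (F := fun u => (x u - x0) * cos (theta (t u)) + (y u - y0) * sin (theta (t u))).
assert (DF : is_derive F 0 (dSigma x0 y0 theta (c 0) (c' 0))).
{ unfold F; auto_derive.
  - repeat split; try apply D; eexists; eassumption.
  - change (fun u => x u) with x; change (fun u => y u) with y;
      change (fun u => t u) with t; change (fun u => theta u) with theta.
    rewrite (is_derive_unique x _ _ Dx), (is_derive_unique y _ _ Dy),
      (is_derive_unique t _ _ Dt).
    unfold dSigma, alpha, radius, dt, t, x, y, z, height.
    destruct (c 0) as [[p1 p2] p3], (c' 0) as [[v1 v2] v3]; simpl; ring. }
rewrite <- (is_derive_unique _ _ _ DF); apply is_derive_unique.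
apply (is_derive_ext_loc (fun _ => 0)); [| exact (is_derive_const (K := R_AbsRing) (V := R_NormedModule) 0 0)].
apply (filter_imp _ _ (fun u H => proj1 H)) in Hloc.
apply (filter_imp _ _) with (2 := Hloc); intros u Hu; symmetry.
unfold F, t, x, y, z; revert Hu; unfold Sigma; simpl.
now destruct (c u) as [[p1 p2] p3].
Qed.

Definition ruled_velocity (x0 y0 : R) (theta : R -> R) (r t m n : R) : R3 :=
  let a := - (m * sin (theta t) + r * (n * Derive theta t * cos (theta t))) in
  let b := m * cos (theta t) - r * (n * Derive theta t * sin (theta t)) in
  (a, b, n + y0 * a - x0 * b).

Lemma is_derive_ruled_point x0 y0 theta r t m n s :
  (forall u, ex_derive theta u) ->
  is_derive (fun u => ruled_point x0 y0 theta (r + m * u) (t + n * u)) s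
    (ruled_velocity x0 y0 theta (r + m * s) (t + n * s) m n).
Proof.
intros D; unfold ruled_point, ruled_velocity.
apply @is_derive_pair; [apply @is_derive_pair |];
  auto_derive; try (repeat split; apply D);
  change (fun u => theta u) with theta; ring.
Qed.

Lemma continuous_ruled_velocity x0 y0 theta r t m n s :
  C_k 2 theta ->
  continuous (fun u => ruled_velocity x0 y0 theta (r + m * u) (t + n * u) m n) s.
Proof.
intros [D1 [D2 _]]; unfold ruled_velocity.
assert (C : forall f : R -> R, ex_derive f s -> continuous f s)
  by (intros f; apply (ex_derive_continuous f)).
apply @continuous_pair; [apply @continuous_pair |];
  apply C; auto_derive; repeat split; (apply D1 || apply D2).
Qed.

(** Conversely a vector killed by the differential is the velocity of a curve
    that is affine in the coordinates (r, t), which parametrize the surface. *)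
Lemma dSigma_tangent_plane x0 y0 theta Htheta p v :
  Sigma_set x0 y0 theta p -> dSigma x0 y0 theta p v = 0 ->
  tangent_plane (Sigma x0 y0 theta Htheta) p v.
Proof.
intros HS Hv; pose proof (Sigma_ruled _ _ _ _ HS) as E.
set (n := height x0 y0 v).
(* The component of v along the ruling direction (- sin, cos). *)
set (m := snd (fst v) * cos (theta (height x0 y0 p))
          - fst (fst v) * sin (theta (height x0 y0 p))).
exists (fun u => ruled_point x0 y0 theta (radius x0 y0 theta p + m * u)
                   (height x0 y0 p + n * u)),
  (fun u => ruled_velocity x0 y0 theta (radius x0 y0 theta p + m * u)
                   (height x0 y0 p + n * u) m n).
split; [| split].
- now rewrite !Rmult_0_r, !Rplus_0_r.
- rewrite !Rmult_0_r, !Rplus_0_r.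
  destruct v as [[a b] c]; unfold dSigma, alpha in Hv; fold n in Hv.
  unfold ruled_velocity; simpl in m.
  set (r := radius x0 y0 theta p) in *; set (t := height x0 y0 p) in *.
  pose proof (cos_sin_sqr (theta t)) as Q.
  set (C := cos (theta t)) in *; set (S := sin (theta t)) in *.
  (* The other component of v, along (cos, sin), is determined by n. *)
  assert (Ha : a = - (m * S + r * (n * Derive theta t * C))).
  { transitivity (a * (C * C + S * S)
                  - C * (a * C + b * S + r * Derive theta t * n));
      [rewrite Q, Hv | unfold m]; ring. }
  assert (Hb : b = m * C - r * (n * Derive theta t * S)).
  { transitivity (b * (C * C + S * S)
                  - S * (a * C + b * S + r * Derive theta t * n));
      [rewrite Q, Hv | unfold m]; ring. }
  rewrite <- Ha, <- Hb; unfold n, height; simpl; f_equal; ring.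
- apply filter_forall; intros s; split; [apply Sigma_ruled_point | split].
  + apply is_derive_ruled_point, (C_k_ex_derive _ _ Htheta).
  + now apply continuous_ruled_velocity.
Qed.

Lemma tangent_plane_Sigma x0 y0 theta Htheta p v :
  Sigma_set x0 y0 theta p ->
  tangent_plane (Sigma x0 y0 theta Htheta) p v <-> dSigma x0 y0 theta p v = 0.
Proof.
intros HS; split;
  [apply tangent_plane_dSigma | now apply dSigma_tangent_plane].
Qed.

(** * Singular points *)

(** The vanishing of the determinant of (dF, Theta) in the basis (alpha, dt). *)
Lemma singular_point_Sigma x0 y0 theta Htheta p :
  singular_point (Sigma x0 y0 theta Htheta) p <->
  Sigma_set x0 y0 theta p /\
  1 + Rsqr (radius x0 y0 theta p) * Derive theta (height x0 y0 p) = 0.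
Proof.
split.
- intros [HS H]; split; [exact HS |].
  pose proof (cos_sin_sqr (theta (height x0 y0 p))) as Q.
  (* The contact vector with alpha = 1 and dt = r has dF = 1 + r^2 theta'. *)
  set (r := radius x0 y0 theta p) in *.
  set (C := cos (theta (height x0 y0 p))) in *.
  set (S := sin (theta (height x0 y0 p))) in *.
  set (v := (C, S, r + y0 * C - x0 * S) : R3).
  assert (Hh : height x0 y0 v = r) by (unfold height, v; simpl; ring).
  assert (Ha : alpha x0 y0 theta p v = 1) by exact Q.
  assert (Hv : contact_plane p v).
  { unfold contact_plane; rewrite (Theta_coframe x0 y0 theta p v HS), Hh, Ha.
    fold r; ring. }
  apply H, tangent_plane_dSigma in Hv.
  unfold dSigma in Hv; rewrite Hh, Ha in Hv; fold r in Hv.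
  rewrite <- Hv; unfold Rsqr; ring.
- intros [HS H]; split; [exact HS | intros v].
  rewrite tangent_plane_Sigma by exact HS.
  unfold contact_plane; rewrite (Theta_coframe x0 y0 theta p v HS).
  unfold dSigma.
  set (r := radius x0 y0 theta p) in *; set (k := Derive theta _) in *.
  set (A := alpha _ _ _ _ _); set (h := height x0 y0 v).
  (* The determinant relation says that Theta = - r dF and dF = r theta' Theta. *)
  split; intros E.
  + transitivity (- r * (A + r * k * h) + h * (1 + Rsqr r * k));
      [unfold Rsqr | rewrite E, H]; ring.
  + transitivity (r * k * (h - r * A) + A * (1 + Rsqr r * k));
      [unfold Rsqr | rewrite E, H]; ring.
Qed.

Theorem theoremC (x0 y0 : R) (theta : R -> R) (Htheta : C_k 2 theta) :
  (forall p : R3, ~ singular_point (Sigma x0 y0 theta Htheta) p) <->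
  (forall t : R, 0 <= Derive theta t).
Proof.
split.
- intros Hreg t; apply Rnot_lt_le; intros Hneg.
  set (r := / sqrt (- Derive theta t)).
  apply (Hreg (ruled_point x0 y0 theta r t)), singular_point_Sigma.
  split; [apply Sigma_ruled_point |].
  rewrite radius_ruled_point, height_ruled_point; unfold r.
  rewrite Rsqr_inv', Rsqr_sqrt by lra; field; lra.
- intros Hpos p Hsing; apply singular_point_Sigma in Hsing as [_ Hdet].
  pose proof (Rmult_le_pos _ _ (Rle_0_sqr (radius x0 y0 theta p))
                (Hpos (height x0 y0 p))); lra.
Qed.
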